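(* Consider the penalized scenario-based Value-at-Risk portfolio problem $\min_{\mathbf{w}\in\Delta}\ \phi(\mathbf{w}) := g(\mathbf{w}) - h(\mathbf{w})$ and the Boosted DC Algorithm (BDCA) with the line search, both as described in the context. Let $\{\mathbf{w}_k\}$ and $\{\mathbf{y}_k\}$ be the sequences generated by the BDCA, with $\mathbf{d}_k=\mathbf{y}_k-\mathbf{w}_k$ and step sizes $\lambda_k$. Then: (i) for all $k\ge 0$, $\phi(\mathbf{y}_k)\le \phi(\mathbf{w}_k)-\rho\,\|\mathbf{d}_k\|^2$; (ii) the line search (the choice of the initial $\lambda_k$ followed by the backtracking loop) terminates after finitely many steps, and $\phi(\mathbf{w}_{k+1})\le \phi(\mathbf{w}_k)-\rho\,\lambda_k^2\,\|\mathbf{d}_k\|^2$; (iii) the sequence $\{\phi(\mathbf{w}_k)\}$ is monotonically decreasing and converges to some $\bar\phi\in\mathbb{R}$; (iv) there exists a subsequence of $\{\mathbf{w}_k\}$ converging to a KKT point of the problem $\min_{\mathbf{w}\in\Delta}\phi(\mathbf{w})$.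
   Context: Data: $n,S\in\mathbb{N}$; scenario vectors $\mathbf{x}_1,\dots,\mathbf{x}_S\in\mathbb{R}^n$ with probabilities $p_1,\dots,p_S\in[0,1]$, $\sum_j p_j=1$. The feasible set is the simplex $\Delta=\{\mathbf{w}\in[0,1]^n:\sum_{i=1}^n w_i=1\}$. For $\mathbf{w}\in\mathbb{R}^n$ relabel the scenarios so that $\mathbf{w}^\top\mathbf{x}_1\le\cdots\le\mathbf{w}^\top\mathbf{x}_S$; for a level $a\in(0,1)$ let $k=\max\{k: \sum_{j=1}^k p_j< a\}$ (with $\max\emptyset=0$) and $\varepsilon=a-\sum_{j=1}^k p_j$, and define the discrete conditional value-at-risk $\mathrm{CVaR}_{X,a}(\mathbf{w})=\frac1a\sum_{j=1}^k p_j\,\mathbf{w}^\top\mathbf{x}_j+\frac{\varepsilon}{a}\,\mathbf{w}^\top\mathbf{x}_{k+1}$ (a concave piecewise linear function of $\mathbf{w}$). Fix $\alpha\in(0,1)$, with $k,\varepsilon$ the quantities above for level $\alpha$, a constant $\gamma$ with $0<\gamma<\varepsilon$, a threshold $r_{\min}\in\mathbb{R}$, a penalty parameter $\tau>0$, a regularization parameter $\rho>0$, and $\psi(\mathbf{w})=\frac{\rho}{2}\|\mathbf{w}\|^2$. Let $f(\mathbf{w})=-\sum_{j=1}^S p_j\,\mathbf{w}^\top\mathbf{x}_j$ and $g(\mathbf{w})=\psi(\mathbf{w})+f(\mathbf{w})+\tau\max\big[-\tfrac{\alpha}{\gamma}\mathrm{CVaR}_{X,\alpha}(\mathbf{w})+r_{\min},\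 -\tfrac{\alpha-\gamma}{\gamma}\mathrm{CVaR}_{X,\alpha-\gamma}(\mathbf{w})\big]$, $h(\mathbf{w})=\psi(\mathbf{w})-\tau\,\tfrac{\alpha-\gamma}{\gamma}\mathrm{CVaR}_{X,\alpha-\gamma}(\mathbf{w})$, and $\phi=g-h$ (both $g$ and $h$ are $\rho$-strongly convex). BDCA: input $\mathbf{w}_0\in\Delta$, $\tau,\rho>0$, $\beta\in(0,1)$. For $k=0,1,2,\dots$: choose $\mathbf{u}_k\in\partial h(\mathbf{w}_k)$ (convex subdifferential); let $\mathbf{y}_k=\arg\min_{\mathbf{w}\in\Delta}\{g(\mathbf{w})-\mathbf{w}^\top\mathbf{u}_k\}$ (unique by strong convexity); $\mathbf{d}_k=\mathbf{y}_k-\mathbf{w}_k$; if $\|\mathbf{d}_k\|=0$ stop; otherwise set $\lambda_k=\max\{\lambda: \mathbf{w}_k+\lambda\mathbf{d}_k\in\Delta\}$ and, while $\phi(\mathbf{w}_k+\lambda_k\mathbf{d}_k)>\phi(\mathbf{w}_k)-\rho\lambda_k^2\|\mathbf{d}_k\|^2$, replace $\lambda_k$ by $\max\{1,\beta\lambda_k\}$; then set $\mathbf{w}_{k+1}=\mathbf{w}_k+\lambda_k\mathbf{d}_k$. A point $\bar{\mathbf{w}}$ is a KKT point of $\min_{\mathbf{w}\in\Delta}\phi$ if there exist $\pi_1,\dots,\pi_n\ge0$ and $\nu\in\mathbb{R}$ with $\mathbf{0}\in\partial g(\bar{\mathbf{w}})-\partial h(\bar{\mathbf{w}})-\sum_{i=1}^n\pi_i\mathbf{e}_i+\nu\mathbf{1}_n$,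 $\pi_i\bar w_i=0$ and $\bar w_i\ge0$ for all $i$, and $\mathbf{1}_n^\top\bar{\mathbf{w}}=1$, where $\mathbf{e}_i$ are the standard basis vectors and $\mathbf{1}_n$ is the all-ones vector. *)

(* Defs.v *)
From HB Require Import structures.
From mathcomp Require Import all_boot all_order all_algebra.
From mathcomp Require Import all_classical all_reals all_analysis.
Set Implicit Arguments. Unset Strict Implicit. Unset Printing Implicit Defensive.
Import Order.TTheory GRing.Theory Num.Theory.
Import numFieldNormedType.Exports.
Local Open Scope ring_scope.
Local Open Scope classical_set_scope.

Definition dotv (R : realType) (n : nat) (u v : 'rV[R]_n) : R :=
  \sum_(i < n) u 0 i * v 0 i.
Definition sqnorm (R : realType) (n : nat) (u : 'rV[R]_n) : R := dotv u u.

Definition in_simplex (R : realType) (n : nat) (w : 'rV[R]_n) : Prop :=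
  (forall i, 0 <= w 0 i <= 1) /\ \sum_(i < n) w 0 i = 1.

Definition scen_order (R : realType) (S : nat) (v : 'I_S -> R) : seq 'I_S :=
  sort (fun i j => v i <= v j) (enum 'I_S).
Definition sorted_probs (R : realType) (S : nat) (p : 'I_S -> R) (v : 'I_S -> R) : seq R :=
  [seq p i | i <- scen_order v].
Definition sorted_vals (R : realType) (S : nat) (v : 'I_S -> R) : seq R :=
  [seq v i | i <- scen_order v].
Definition psum (R : realType) (S : nat) (p v : 'I_S -> R) (k : nat) : R :=
  \sum_(j < k) nth 0 (sorted_probs p v) j.
(* k = max{k : sum_{j<=k} p_j < a} (max of empty = 0) *)
Definition cvar_k (R : realType) (S : nat) (p v : 'I_S -> R) (a : R) : nat :=
  \max_(k < S.+1 | (psum p v k < a)%R) (k : nat).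
Definition cvar_eps (R : realType) (S : nat) (p v : 'I_S -> R) (a : R) : R :=
  a - psum p v (cvar_k p v a).
Definition cvar_vals (R : realType) (S : nat) (p v : 'I_S -> R) (a : R) : R :=
  a^-1 * (\sum_(j < cvar_k p v a)
            nth 0 (sorted_probs p v) j * nth 0 (sorted_vals v) j)
  + cvar_eps p v a / a * nth 0 (sorted_vals v) (cvar_k p v a).

Definition port_vals (R : realType) (n S : nat) (x : 'I_S -> 'rV[R]_n)
  (w : 'rV[R]_n) : 'I_S -> R := fun j => dotv w (x j).

Definition CVaR (R : realType) (n S : nat) (x : 'I_S -> 'rV[R]_n) (p : 'I_S -> R)
  (a : R) (w : 'rV[R]_n) : R := cvar_vals p (port_vals x w) a.
Definition CVaR_eps (R : realType) (n S : nat) (x : 'I_S -> 'rV[R]_n) (p : 'I_S -> R)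
  (a : R) (w : 'rV[R]_n) : R := cvar_eps p (port_vals x w) a.

Definition psi (R : realType) (n : nat) (rho : R) (w : 'rV[R]_n) : R :=
  rho / 2 * sqnorm w.
Definition ffun_obj (R : realType) (n S : nat) (x : 'I_S -> 'rV[R]_n) (p : 'I_S -> R)
  (w : 'rV[R]_n) : R := - \sum_(j < S) p j * dotv w (x j).

Definition gfun (R : realType) (n S : nat) (x : 'I_S -> 'rV[R]_n) (p : 'I_S -> R)
  (al ga rmin tau rho : R) (w : 'rV[R]_n) : R :=
  psi rho w + ffun_obj x p w
  + tau * Num.max (- (al / ga) * CVaR x p al w + rmin)
                  (- ((al - ga) / ga) * CVaR x p (al - ga) w).
Definition hfun (R : realType) (n S : nat) (x : 'I_S -> 'rV[R]_n) (p : 'I_S -> R)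
  (al ga tau rho : R) (w : 'rV[R]_n) : R :=
  psi rho w - tau * ((al - ga) / ga) * CVaR x p (al - ga) w.
Definition phifun (R : realType) (n S : nat) (x : 'I_S -> 'rV[R]_n) (p : 'I_S -> R)
  (al ga rmin tau rho : R) (w : 'rV[R]_n) : R :=
  gfun x p al ga rmin tau rho w - hfun x p al ga tau rho w.

Definition subdiff (R : realType) (n : nat) (f : 'rV[R]_n -> R) (w u : 'rV[R]_n) : Prop :=
  forall z, f w + dotv u (z - w) <= f z.

Definition lam_max (R : realType) (n : nat) (w d : 'rV[R]_n) : R :=
  sup [set l : R | in_simplex (w + l *: d)].
Definition ls_trial (R : realType) (beta l0 : R) (j : nat) : R :=
  iter j (fun l => Num.max 1 (beta * l)) l0.
Definition armijo (R : realType) (n : nat) (phi : 'rV[R]_n -> R) (rho : R)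
  (w d : 'rV[R]_n) (l : R) : Prop :=
  phi (w + l *: d) <= phi w - rho * l ^+ 2 * sqnorm d.
Definition ls_output (R : realType) (n : nat) (phi : 'rV[R]_n -> R) (rho beta : R)
  (w d : 'rV[R]_n) (l : R) : Prop :=
  exists j : nat, armijo phi rho w d (ls_trial beta (lam_max w d) j)
    /\ (forall i, (i < j)%N -> ~ armijo phi rho w d (ls_trial beta (lam_max w d) i))
    /\ l = ls_trial beta (lam_max w d) j.

Definition is_KKT (R : realType) (n : nat) (g h : 'rV[R]_n -> R) (wb : 'rV[R]_n) : Prop :=
  exists (pi : 'I_n -> R) (nu : R) (a b : 'rV[R]_n),
    subdiff g wb a /\ subdiff h wb b /\
    a - b - \sum_(i < n) pi i *: delta_mx 0 i + nu *: const_mx 1 = 0 /\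
    (forall i, 0 <= pi i /\ pi i * wb 0 i = 0 /\ 0 <= wb 0 i) /\
    \sum_(i < n) wb 0 i = 1.

(* Main.v *)
Require Import Defs.
From HB Require Import structures.
From mathcomp Require Import all_boot all_order all_algebra.
From mathcomp Require Import all_classical all_reals all_analysis.
From mathcomp Require Import ring lra.
Import Order.TTheory GRing.Theory Num.Theory.
Import numFieldNormedType.Exports.
Local Open Scope ring_scope.
Local Open Scope classical_set_scope.

(* [a * CVaR_a] is the minimum of [\sum_j q_j (w . x_j)] over the weights
   [0 <= q <= p] of total mass [a]; hence [- CVaR_a] is convex with uniformly
   bounded subgradients, and [g] and [h] are [psi] plus functions of this kind.
   Strong convexity of [g] at its constrained minimiser [y_k] and of [h] at
   [w_k] add up to the decrease [rho * |d_k|^2]; it makes the trial step 1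
   acceptable, so backtracking stops, and it forces [d_k --> 0].  Along a
   subsequence [w_k] and the bounded [u_k] converge to some [wb] and [ub], with
   [ub] a subgradient of [h] at [wb] and [wb] a minimiser of
   [g - <., ub>] on the simplex.  A finite-dimensional Hahn-Banach argument
   then yields a subgradient [a] of that function at [wb] which is nonnegative
   on feasible directions, and the multipliers are [pi_i = a_i - <a, wb>]. *)

(** * Algebra of the dot product and the squared norm *)

Section dot_product.
Context {R : realType} {n : nat}.
Implicit Types a b c : 'rV[R]_n.

Lemma dotvC a b : dotv a b = dotv b a.
Proof. by apply: eq_bigr => i _; rewrite mulrC. Qed.

Lemma dotvDr a b c : dotv a (b + c) = dotv a b + dotv a c.
Proof. by rewrite -big_split; apply: eq_bigr => i _; rewrite mxE mulrDr. Qed.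

Lemma dotvZr t a b : dotv a (t *: b) = t * dotv a b.
Proof. by rewrite mulr_sumr; apply: eq_bigr => i _; rewrite mxE mulrCA. Qed.

Lemma dotvNr a b : dotv a (- b) = - dotv a b.
Proof. by rewrite -scaleN1r dotvZr mulN1r. Qed.

Lemma dotvBr a b c : dotv a (b - c) = dotv a b - dotv a c.
Proof. by rewrite dotvDr dotvNr. Qed.

Lemma dotvDl a b c : dotv (a + b) c = dotv a c + dotv b c.
Proof. by rewrite dotvC dotvDr !(dotvC c). Qed.

Lemma dotvZl t a b : dotv (t *: a) b = t * dotv a b.
Proof. by rewrite dotvC dotvZr (dotvC b). Qed.

Lemma dotvNl a b : dotv (- a) b = - dotv a b.
Proof. by rewrite dotvC dotvNr (dotvC b). Qed.

Lemma dotv0r a : dotv a 0 = 0.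
Proof. by rewrite /dotv big1 // => i _; rewrite mxE mulr0. Qed.

Lemma dotv_delta a i : dotv a (delta_mx 0 i) = a 0 i.
Proof.
rewrite /dotv (bigD1 i) //= mxE !eqxx mulr1 big1 ?addr0 // => j ji.
by rewrite mxE (negbTE ji) andbF mulr0.
Qed.

Lemma dotv_suml (I : Type) (r : seq I) (F : I -> 'rV[R]_n) b :
  dotv (\sum_(j <- r) F j) b = \sum_(j <- r) dotv (F j) b.
Proof.
elim/big_rec2: _ => [|j s1 s2 _ <-]; first by rewrite dotvC dotv0r.
by rewrite dotvDl.
Qed.

Lemma sqnorm_ge0 a : 0 <= sqnorm a.
Proof. by apply: sumr_ge0 => i _; rewrite -expr2 sqr_ge0. Qed.

Lemma sqr_coord_le_sqnorm a i : (a 0 i) ^+ 2 <= sqnorm a.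
Proof.
rewrite /sqnorm /dotv (bigD1 i) //= -expr2 lerDl.
by apply: sumr_ge0 => j _; rewrite -expr2 sqr_ge0.
Qed.

Lemma sqnormN a : sqnorm (- a) = sqnorm a.
Proof. by rewrite /sqnorm dotvNl dotvNr opprK. Qed.

Lemma sqnormD a b : sqnorm (a + b) = sqnorm a + 2 * dotv a b + sqnorm b.
Proof. rewrite /sqnorm dotvDl !dotvDr (dotvC b a); ring. Qed.

Lemma sqnormZ t a : sqnorm (t *: a) = t ^+ 2 * sqnorm a.
Proof. by rewrite /sqnorm dotvZl dotvZr mulrA expr2. Qed.

Lemma dotv_abs_le M a b : (forall i, `|a 0 i| <= M) ->
  `|dotv a b| <= M * \sum_(i < n) `|b 0 i|.
Proof.
move=> aM; apply: (le_trans (ler_norm_sum _ _ _)); rewrite mulr_sumr.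
by apply: ler_sum => i _; rewrite normrM ler_wpM2r.
Qed.

End dot_product.

(** * Convexity notions and inequalities for strongly convex functions *)

Definition convex_fct {R : realType} {n : nat} (f : 'rV[R]_n -> R) :=
  forall a b t, 0 <= t <= 1 ->
    f (t *: a + (1 - t) *: b) <= t * f a + (1 - t) * f b.

Definition strongly_convex {R : realType} {n : nat} (rho : R) (f : 'rV[R]_n -> R) :=
  forall a b t, 0 <= t <= 1 ->
    f (t *: a + (1 - t) *: b) + rho / 2 * (t * (1 - t) * sqnorm (a - b))
      <= t * f a + (1 - t) * f b.

Definition convex_dom {R : realType} {n : nat} (K : 'rV[R]_n -> Prop) :=
  forall a b t, 0 <= t <= 1 -> K a -> K b -> K (t *: a + (1 - t) *: b).

(* Bounded subgradients everywhere encode convexity and global Lipschitz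
   continuity at once, and are stable under sums, nonnegative scalings and
   maxima. *)
Definition lip_convex {R : realType} {n : nat} (f : 'rV[R]_n -> R) :=
  exists M : R, forall w, exists s : 'rV_n, (forall i, `|s 0 i| <= M) /\ subdiff f w s.

(** Splitting off the quadratic part exactly yields strong convexity with modulus [rho], and makes
    [psi] cancel in a difference of two such functions. *)
Definition psi_convex {R : realType} {n : nat} (rho : R) (f : 'rV[R]_n -> R) :=
  exists2 L, lip_convex L & forall w, f w = psi rho w + L w.

Section lip_convex.
Context {R : realType} {n : nat}.
Implicit Types f g L : 'rV[R]_n -> R.

Lemma lip_convexD f g : lip_convex f -> lip_convex g ->
  lip_convex (fun w => f w + g w).
Proof.
move=> [M fM] [N gN]; exists (M + N) => w.
have [s [sM sf]] := fM w; have [t [tN tg]] := gN w.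
exists (s + t); split=> [i|z].
  by rewrite mxE (le_trans (ler_normD _ _))// lerD.
by rewrite dotvDl addrACA lerD.
Qed.

Lemma lip_convexZ c f : 0 <= c -> lip_convex f -> lip_convex (fun w => c * f w).
Proof.
move=> c0 [M fM]; exists (c * M) => w; have [s [sM sf]] := fM w.
exists (c *: s); split=> [i|z].
  by rewrite mxE normrM (ger0_norm c0) ler_wpM2l.
by rewrite dotvZl -mulrDr ler_wpM2l.
Qed.

Lemma lip_convex_cst (c : R) : lip_convex (fun _ : 'rV[R]_n => c).
Proof.
exists 0 => w; exists 0; split=> [i|z]; first by rewrite mxE normr0.
by rewrite dotvC dotv0r addr0.
Qed.

Lemma lip_convex_max f g : lip_convex f -> lip_convex g ->
  lip_convex (fun w => Num.max (f w) (g w)).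
Proof.
move=> [M fM] [N gN]; exists (Num.max M N) => w.
have [s [sM sf]] := fM w; have [t [tN tg]] := gN w.
have [le_gf|lt_fg] := leP (g w) (f w).
- exists s; split=> [i|z]; first by rewrite le_max sM.
  by rewrite le_max (max_idPl le_gf) sf.
- exists t; split=> [i|z]; first by rewrite le_max tN orbT.
  by rewrite le_max (max_idPr (ltW lt_fg)) tg orbT.
Qed.

Lemma coord_le_sum (a : 'rV[R]_n) i : `|a 0 i| <= \sum_(j < n) `|a 0 j|.
Proof. by rewrite (bigD1 i) //= lerDl sumr_ge0. Qed.

Lemma lip_convex_linear (a : 'rV[R]_n) : lip_convex (dotv a).
Proof.
exists (\sum_(j < n) `|a 0 j|) => w; exists a; split; first exact: coord_le_sum.
by move=> z; rewrite -dotvDr addrC subrK.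
Qed.

Lemma lip_convex_lipschitz f : lip_convex f ->
  exists2 M, 0 <= M & forall z w, `|f z - f w| <= M * \sum_(i < n) `|(z - w) 0 i|.
Proof.
(* For [n = 0] the coordinate bounds are vacuous and [M] may be negative, hence the absolute
   value. *)
move=> [M fM]; exists `|M| => // z w.
have [s [sM sf]] := fM w; have [t [tM tf]] := fM z.
have absM (r : 'rV[R]_n) : (forall i, `|r 0 i| <= M) -> forall i, `|r 0 i| <= `|M|.
  by move=> rM i; apply: le_trans (rM i) (ler_norm _).
have := sf z; have := tf w; rewrite -(opprB z w) dotvNr => ht hs.
have := dotv_abs_le _ _ (z - w) (absM _ sM); rewrite ler_norml => /andP[hs1 _].
have := dotv_abs_le _ _ (z - w) (absM _ tM); rewrite ler_norml => /andP[_ ht1].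
rewrite ler_norml; apply/andP; split; lra.
Qed.

Lemma lip_convex_convex f : lip_convex f -> convex_fct f.
Proof.
move=> [M fM] a b t /andP[t0 t1].
have [s [_ sf]] := fM (t *: a + (1 - t) *: b).
have := sf a; have := sf b; rewrite !dotvBr !dotvDr !dotvZr.
set m := f (_ + _); move=> hb ha.
have : t * (m + (dotv s a - (t * dotv s a + (1 - t) * dotv s b))) <= t * f a.
  exact: ler_wpM2l.
have : (1 - t) * (m + (dotv s b - (t * dotv s a + (1 - t) * dotv s b)))
  <= (1 - t) * f b by rewrite ler_wpM2l// subr_ge0.
nra.
Qed.

Lemma psi_combination rho (a b : 'rV[R]_n) t :
  psi rho (t *: a + (1 - t) *: b) + rho / 2 * (t * (1 - t) * sqnorm (a - b))
  = t * psi rho a + (1 - t) * psi rho b.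
Proof.
rewrite /psi !sqnormD !sqnormZ sqnormN dotvZl dotvZr dotvNr; ring.
Qed.

Lemma psi_convex_strongly rho f : psi_convex rho f -> strongly_convex rho f.
Proof.
move=> [L /lip_convex_convex Lc fE] a b t t01.
rewrite !fE addrAC psi_combination !mulrDr addrACA lerD2l.
exact: Lc.
Qed.

Lemma strongly_convex_convex rho f : 0 <= rho ->
  strongly_convex rho f -> convex_fct f.
Proof.
move=> rho0 fc a b t t01; apply: le_trans (fc a b t t01).
case/andP: t01 => t0 t1; rewrite lerDl !mulr_ge0 ?invr_ge0 ?subr_ge0//.
exact: sqnorm_ge0.
Qed.

Lemma strongly_convexB_linear rho f u : strongly_convex rho f ->
  strongly_convex rho (fun z => f z - dotv z u).
Proof.
move=> fc a b t t01; have := fc a b t t01.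
rewrite dotvDl !dotvZl; lra.
Qed.

(** Comparing [y] with the points [t *: z + (1 - t) *: y] of [K] gives [(1 - t) * c <= f z - f y]
    for [0 < t <= 1], where [c] is the quadratic term; the claim is the limit at [t = 0]. *)
Lemma strongly_convex_min rho f (K : 'rV[R]_n -> Prop) y z :
  0 <= rho -> strongly_convex rho f -> convex_dom K -> K y -> K z ->
  (forall z', K z' -> f y <= f z') ->
  f y + rho / 2 * sqnorm (z - y) <= f z.
Proof.
move=> rho0 fc Kc Ky Kz ymin; rewrite leNgt; apply/negP.
set c := rho / 2 * sqnorm (z - y) => hlt.
pose e := f y + c - f z.
have e0 : 0 < e by rewrite subr_gt0.
have small t : 0 < t -> t <= 1 -> e <= c * t.
  move=> t0 t1; have t01 : 0 <= t <= 1 by rewrite ltW.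
  have := le_trans (lerD (ymin _ (Kc z y t t01 Kz Ky)) (lexx _)) (fc z y t t01).
  rewrite (_ : rho / 2 * _ = t * ((1 - t) * c)); last by rewrite /c; ring.
  move=> h; have : t * (e - c * t) <= 0 by rewrite /e; lra.
  by rewrite pmulr_rle0// subr_le0.
(* The choice [t = 1/2] shows that [c > 0] and that [e / (2 * c)] is an admissible [t]; this second
   choice gives [e <= e / 2], against [e > 0]. *)
have ec : e <= c / 2 by apply: small; lra.
have c0 : 0 < c by lra.
have : e <= c * (e / (2 * c)).
  apply: small; first by rewrite divr_gt0// mulr_gt0.
  by rewrite ler_pdivrMr; lra.
rewrite (_ : c * _ = e / 2); first by lra.
by field; rewrite gt_eqF.
Qed.

(** Subtracting the linear form of [u] turns [w] into a global minimiser, so the growth estimate at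
    a minimiser applies on the whole space. *)
Lemma strongly_convex_subdiff rho f w u z :
  0 <= rho -> strongly_convex rho f -> subdiff f w u ->
  f w + dotv u (z - w) + rho / 2 * sqnorm (z - w) <= f z.
Proof.
move=> rho0 /(strongly_convexB_linear _ _ u) fc uf.
have := strongly_convex_min _ _ (fun=> True) w z rho0 fc.
have Tc : convex_dom (fun _ : 'rV[R]_n => True) by [].
move=> /(_ Tc I I) hmin.
have /hmin : forall z', True -> f w - dotv w u <= f z' - dotv z' u.
  by move=> z' _; have := uf z'; rewrite dotvBr !(dotvC u); lra.
by rewrite dotvBr !(dotvC u); lra.
Qed.

End lip_convex.

(** * Finite-dimensional Hahn-Banach and subgradients at constrained minimisers *)

Section hahn_banach.
Context {R : realType} {n : nat}.
Implicit Types (p f : 'rV[R]_n -> R) (a d z : 'rV[R]_n).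

(* One-dimensional extension: the slopes coming from the negative multiples of
   [e] lie below those coming from the positive ones, by convexity. *)
Lemma convex_slope_separation p a (V : 'rV[R]_n -> Prop) e :
  convex_fct p ->
  (forall z z' s t, V z -> V z' -> V (s *: z + t *: z')) -> V 0 ->
  (forall z, V z -> dotv a z <= p z) ->
  exists c, forall z t, V z -> dotv a z + c * t <= p (z + t *: e).
Proof.
move=> pc Vlin V0 aV.
have slopes z z' s t : 0 < s -> 0 < t -> V z -> V z' ->
    (dotv a z' - p (z' - s *: e)) / s <= (p (z + t *: e) - dotv a z) / t.
  move=> s0 t0 Vz Vz'.
  have st0 : 0 < s + t by rewrite addr_gt0.
  (* With this weight [l * t = (1 - l) * s], so the multiples of [e] cancel in the convex
     combination. *)
  pose l := s / (s + t).
  have lE : 1 - l = t / (s + t) by rewrite /l; field; rewrite gt_eqF.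
  have l01 : 0 <= l <= 1.
    apply/andP; split; first by rewrite divr_ge0// ltW.
    by rewrite /l ler_pdivrMr// mul1r lerDl ltW.
  have := pc (z + t *: e) (z' - s *: e) l l01.
  have -> : l *: (z + t *: e) + (1 - l) *: (z' - s *: e)
      = l *: z + (1 - l) *: z'.
    rewrite !scalerDr !scalerN !scalerA addrACA lE.
    by rewrite (_ : t / _ * s = l * t) ?subrr ?addr0// /l; ring.
  move=> /(le_trans (aV _ (Vlin _ _ _ _ Vz Vz'))).
  rewrite dotvDr !dotvZr lE /l => h.
  rewrite ler_pdivrMr// mulrAC ler_pdivlMr//.
  have := ler_wpM2r (ltW st0) h.
  rewrite !mulrDl.
  have simp (r q : R) : r / (s + t) * q * (s + t) = r * q.
    by field; rewrite gt_eqF.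
  by rewrite !simp; lra.
pose E := [set x | exists s z, [/\ 0 < s, V z &
  x = (dotv a z - p (z - s *: e)) / s]].
have E0 : E !=set0.
  by exists ((dotv a 0 - p (0 - 1 *: e)) / 1), 1, 0.
exists (sup E) => z t Vz.
have [t0|t0|->] := ltgtP t 0; last by rewrite mulr0 addr0 scale0r addr0 aV.
- have : E ((dotv a z - p (z - (- t) *: e)) / (- t)).
    by exists (- t), z; rewrite oppr_gt0.
  have ubE : has_ubound E.
    exists ((p (0 + 1 *: e) - dotv a 0) / 1) => _ [s [z' [s0 Vz' ->]]].
    exact: slopes.
  move=> /(ub_le_sup ubE); rewrite ler_pdivrMr ?oppr_gt0// scaleNr opprK.
  by lra.
- have : sup E <= (p (z + t *: e) - dotv a z) / t.
    apply: ge_sup => // _ [s [z' [s0 Vz' ->]]]; exact: slopes.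
  by rewrite ler_pdivlMr//; lra.
Qed.

(** Coordinates are adjoined one at a time: [V m] is the span of the first [m] basis vectors, and on
    [V 0] the claim is just [0 <= p 0]. *)
Lemma convex_linear_minorant p : convex_fct p -> 0 <= p 0 ->
  exists a, forall z, dotv a z <= p z.
Proof.
move=> pc p0.
pose V (m : nat) z := forall i : 'I_n, (m <= i)%N -> z 0 i = 0.
suff ext m : exists a, forall z, V m z -> dotv a z <= p z.
  have [a aV] := ext n; exists a => z; apply: aV => i.
  by rewrite leqNgt ltn_ord.
elim: m => [|m [a aV]].
  exists 0 => z Vz; rewrite (_ : z = 0) ?dotv0r//.
  by apply/rowP => i; rewrite Vz// mxE.
have [mn|nm] := ltnP m n; last first.
  exists a => z Vz; apply: aV => i mi.
  by have := leq_trans nm mi; rewrite leqNgt ltn_ord.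
pose im := Ordinal mn.
have [||c cP] := @convex_slope_separation p a (V m) (delta_mx 0 im) pc _ _ aV.
- by move=> z z' s t Vz Vz' i mi; rewrite !mxE Vz// Vz'// !mulr0 addr0.
- by move=> i _; rewrite mxE.
(* Coordinate [m] of [a] is replaced by the slope [c]; [z] splits into [z0] in [V m] and a multiple
   of the new basis vector. *)
exists (a + (c - a 0 im) *: delta_mx 0 im) => z Vz.
pose z0 := z - z 0 im *: delta_mx 0 im.
have Vz0 : V m z0.
  move=> i mi; rewrite !mxE eqxx /=.
  have [->|ne] := eqVneq i im; first by rewrite mulr1 subrr.
  rewrite mulr0 subr0 Vz// ltn_neqAle mi andbT; apply: contra_neq ne => h.
  exact/val_inj.
have := cP z0 (z 0 im) Vz0; rewrite subrK; apply: le_trans.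
rewrite dotvDl dotvZl (dotvC (delta_mx _ _)) dotv_delta.
by rewrite dotvBr dotvZr dotv_delta; lra.
Qed.

(* The convex function [d |-> inf_(z in K) f (z + d) - f w] is nonnegative at 0
   because [w] is a minimiser, and any linear minorant of it is the required
   subgradient. *)
Lemma constrained_min_subgradient f (K : 'rV[R]_n -> Prop) w :
  convex_fct f -> convex_dom K -> K w -> (forall z, K z -> f w <= f z) ->
  exists a, subdiff f w a /\ forall z, K z -> 0 <= dotv a (z - w).
Proof.
move=> fc Kc Kw wmin.
pose E d := [set f (z + d) | z in [set z | K z]].
pose p d := inf (E d) - f w.
have En0 d : E d !=set0 by exists (f (w + d)), w.
have half : 0 <= (2^-1 : R) <= 1 by lra.
have Elb d : has_lbound (E d).
  (* The midpoint of [z + d] and [w - d] is that of [z] and [w], which lies in [K], so [f] is at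
     least [f w] there. *)
  exists (2 * f w - f (w - d)) => _ [z Kz <-].
  have := fc (z + d) (w - d) 2^-1 half.
  have -> : 2^-1 *: (z + d) + (1 - 2^-1) *: (w - d)
      = 2^-1 *: z + (1 - 2^-1) *: w.
    by apply/rowP => i; rewrite !mxE; field.
  by move=> /(le_trans (wmin _ (Kc _ _ _ half Kz Kw))); lra.
have Ele d z : K z -> inf (E d) <= f (z + d).
  by move=> Kz; apply: ge_inf; [exact: Elb | exists z].
have pc : convex_fct p.
  move=> d d' t t01; case/andP: (t01) => t0 t1.
  apply/ler_addgt0Pr => e e0.
  have [_ [z Kz <-] hz] := inf_adherent e0 (conj (En0 d) (Elb d)).
  have [_ [z' Kz' <-] hz'] := inf_adherent e0 (conj (En0 d') (Elb d')).
  have := Ele (t *: d + (1 - t) *: d') _ (Kc _ _ _ t01 Kz Kz').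
  have -> : t *: z + (1 - t) *: z' + (t *: d + (1 - t) *: d')
      = t *: (z + d) + (1 - t) *: (z' + d').
    by rewrite !scalerDr addrACA.
  move=> /le_trans /(_ (fc _ _ _ t01)).
  have : t * f (z + d) <= t * (inf (E d) + e) by rewrite ler_wpM2l// ltW.
  have : (1 - t) * f (z' + d') <= (1 - t) * (inf (E d') + e).
    by rewrite ler_wpM2l ?subr_ge0// ltW.
  by rewrite /p; lra.
have p0 : 0 <= p 0.
  rewrite subr_ge0; apply: lb_le_inf => // _ [z Kz <-].
  by rewrite addr0 wmin.
have [a ap] := convex_linear_minorant _ pc p0; exists a; split.
  move=> z; have := ap (z - w); have := Ele (z - w) w Kw.
  by rewrite [w + _]addrC subrK /p; lra.
(* In direction [w - z] the point [z] is a competitor with value [f w], so [p (w - z) <= 0]. *)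
move=> z Kz; have := ap (w - z); have := Ele (w - z) z Kz.
by rewrite [z + _]addrC subrK /p -(opprB z w) dotvNr; lra.
Qed.

End hahn_banach.

(** * The simplex: KKT multipliers and maximal feasible steps *)

Section simplex.
Context {R : realType} {n : nat}.
Implicit Types (g h : 'rV[R]_n -> R) (w y d : 'rV[R]_n).

Lemma in_simplexP w : in_simplex w <->
  (forall i, 0 <= w 0 i) /\ \sum_(i < n) w 0 i = 1.
Proof.
split=> -[w0 w1]; split=> // i; first by case/andP: (w0 i).
rewrite w0/= -w1 (bigD1 i)//= lerDl; exact: sumr_ge0.
Qed.

Lemma simplex_convex : convex_dom (@in_simplex R n).
Proof.
move=> a b t /andP[t0 t1] /in_simplexP[a0 a1] /in_simplexP[b0 b1].
apply/in_simplexP; split=> [i|].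
  by rewrite !mxE addr_ge0// mulr_ge0// subr_ge0.
under eq_bigr do rewrite !mxE.
by rewrite big_split/= -!mulr_sumr a1 b1 !mulr1 addrC subrK.
Qed.

Lemma simplex_delta i : in_simplex (delta_mx 0 i : 'rV[R]_n).
Proof.
apply/in_simplexP; split=> [j|]; first by rewrite mxE ler0n.
rewrite (bigD1 i)//= mxE !eqxx big1 ?addr0// => j ji.
by rewrite mxE (negbTE ji) andbF.
Qed.

(** Testing [a] towards the vertices gives [pi i >= 0]. As the weights sum to 1, the sum of the
    [pi i * w 0 i] is 0; its terms are nonnegative, which is complementary slackness. *)
Lemma simplex_min_KKT g h w b : convex_fct (fun z => g z - dotv z b) ->
  subdiff h w b -> in_simplex w ->
  (forall z, in_simplex z -> g w - dotv w b <= g z - dotv z b) ->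
  is_KKT g h w.
Proof.
move=> gc hb Dw wmin.
have [a [ag aD]] := constrained_min_subgradient _ _ _ gc simplex_convex Dw wmin.
have /in_simplexP[w0 w1] := Dw.
pose pi i := a 0 i - dotv a w.
have pi0 i : 0 <= pi i.
  by have := aD _ (simplex_delta i); rewrite dotvBr dotv_delta.
have piw : \sum_(i < n) pi i * w 0 i = 0.
  under eq_bigr do rewrite mulrBl.
  by rewrite sumrB -mulr_sumr w1 mulr1 subrr.
exists pi, (- dotv a w), (a + b), b; split=> [z|].
  by have := ag z; rewrite dotvDl (dotvBr b) !(dotvC b); lra.
split=> //; split.
  apply/rowP => i; rewrite !mxE summxE (bigD1 i)//= big1; last first.
    by move=> j ji; rewrite !mxE eq_sym (negbTE ji) andbF mulr0.
  by rewrite !mxE !eqxx /= mulr1 /pi; ring.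
split=> // i; split=> //; split=> //.
move/eqP: piw; rewrite psumr_eq0; last by move=> j _; rewrite mulr_ge0.
by move/allP => /(_ i); rewrite mem_index_enum => /(_ isT)/eqP.
Qed.

Lemma lam_max_ge1 w y : in_simplex w -> in_simplex y -> y != w ->
  has_sup [set l : R | in_simplex (w + l *: (y - w))] /\ 1 <= lam_max w (y - w).
Proof.
move=> Dw Dy yw; set E := [set l | _].
have E1 : E 1 by rewrite /E/= scale1r addrC subrK.
have [i di] : exists i, (y - w) 0 i != 0.
  apply/existsP; rewrite -negb_forall; apply: contra yw => /forallP h.
  by rewrite -subr_eq0; apply/eqP/rowP => i; rewrite (eqP (h i)) mxE.
have ubE : has_ubound E.
  (* Coordinate [i] of [w] and of [w + l *: (y - w)] both lie in [[0,1]], so their difference has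
     absolute value at most 1. *)
  exists (`|(y - w) 0 i|^-1) => l [+ _] => /(_ i).
  case: Dw => [/(_ i) /andP[w0 w1] _]; rewrite 2!mxE => /andP[l0 l1].
  rewrite -[leRHS]mul1r ler_pdivlMr ?normr_gt0//.
  apply: (le_trans (ler_wpM2r (normr_ge0 _) (ler_norm l))).
  by rewrite -normrM ler_norml; apply/andP; split; lra.
split; last exact: ub_le_sup.
by split=> //; exists 1.
Qed.

Lemma simplex_step w y l : in_simplex w -> in_simplex y -> y != w ->
  1 <= l <= lam_max w (y - w) -> in_simplex (w + l *: (y - w)).
Proof.
move=> Dw Dy yw /andP[l1 lmax].
have [hs _] := lam_max_ge1 _ _ Dw Dy yw.
have /in_simplexP[w0 w1] := Dw; have /in_simplexP[y0 y1] := Dy.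
apply/in_simplexP; split; last first.
  under eq_bigr do rewrite !mxE.
  by rewrite big_split/= -mulr_sumr sumrB w1 y1 subrr mulr0 addr0.
move=> i; rewrite leNgt; apply/negP; rewrite 2!mxE.
set di := (y - w) 0 i => neg.
have di0 : di < 0.
  rewrite ltNge; apply/negP => di0; move: neg; rewrite ltNge addr_ge0//.
  by rewrite mulr_ge0//; lra.
(* This is how far [l] overshoots the zero of coordinate [i]; a feasible [l'] closer than that to
   the supremum would also be past the zero. *)
have e0 : 0 < (w 0 i + l * di) / di by rewrite ltr_ndivlMr// mul0r.
have [l' /in_simplexP[/(_ i) + _]] := sup_adherent e0 hs.
rewrite 2!mxE -/di => l'0 lt_l'.
have : (l - (w 0 i + l * di) / di) < l'.
  by apply: le_lt_trans lt_l'; rewrite lerD2r.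
rewrite -(ltr_nM2r di0) mulrBl divfK ?lt_eqF//; lra.
Qed.

End simplex.

(** * Backtracking trial steps *)

Section line_search.
Context {R : realType}.
Variables (beta l0 : R).
Hypotheses (beta01 : 0 < beta < 1) (l0_ge1 : 1 <= l0).

Lemma ls_trial_bounds j : 1 <= ls_trial beta l0 j <= l0.
Proof.
case/andP: beta01 => b0 b1.
elim: j => [|j /andP[ih1 ih2]]; first by rewrite /ls_trial/= l0_ge1/=.
rewrite /ls_trial/= -/(ls_trial beta l0 j) le_max lexx/= ge_max l0_ge1/=.
by apply: le_trans ih2; rewrite ler_piMl ?ltW// (lt_le_trans ltr01).
Qed.

Lemma ls_trial_le j : ls_trial beta l0 j <= Num.max 1 (beta ^+ j * l0).
Proof.
case/andP: beta01 => b0 b1.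
elim: j => [|j ih]; first by rewrite /ls_trial/= expr0 mul1r le_max lexx orbT.
rewrite /ls_trial/= -/(ls_trial beta l0 j) ge_max !le_max lexx/=.
have := ler_wpM2l (ltW b0) ih; rewrite (maxr_pMr _ _ (ltW b0)) le_max mulr1.
case/orP => h; first by rewrite (le_trans h (ltW b1)).
by rewrite exprS -mulrA h orbT.
Qed.

(** Since [beta ^+ j * l0] tends to 0 it drops to 1 or less, and the truncation then makes the trial
    step exactly 1. *)
Lemma ls_trial_eventually1 : exists j, ls_trial beta l0 j = 1.
Proof.
case/andP: (beta01) => b0 b1.
have [j hj] : exists j, beta ^+ j * l0 <= 1.
  have : (fun j => beta ^+ j * l0) @ \oo --> 0 * l0.
    by apply: cvgMl; apply: cvg_expr; rewrite gtr0_norm.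
  rewrite mul0r => /cvgr0Pnorm_le /(_ 1 ltr01)[N _ /(_ N)/= hN].
  by exists N; apply: le_trans (ler_norm _) (hN (leqnn _)).
exists j; apply/eqP; rewrite eq_le (andP (ls_trial_bounds j)).1 andbT.
by apply: le_trans (ls_trial_le j) _; rewrite ge_max lexx.
Qed.

End line_search.

(** * CVaR as the value of a linear program *)

Section cvar.
Context {R : realType} {S : nat}.
Variables (p v : 'I_S -> R) (a : R).
Hypotheses (p01 : forall j, 0 <= p j <= 1) (p1 : \sum_(j < S) p j = 1).
Hypothesis a01 : 0 < a < 1.

Let o := scen_order v.
Let k := cvar_k p v a.
Let eps := cvar_eps p v a.

Lemma scenarios_gt0 : (0 < S)%N.
Proof.
by case: S p p1 => // q /eqP; rewrite big_ord0 eq_sym oner_eq0.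
Qed.

Let i0 : 'I_S := Ordinal scenarios_gt0.

Lemma size_scen_order : size o = S.
Proof. by rewrite size_sort size_enum_ord. Qed.

Lemma scen_order_uniq : uniq o.
Proof. by rewrite sort_uniq enum_uniq. Qed.

Lemma mem_scen_order j : j \in o.
Proof. by rewrite mem_sort mem_enum. Qed.

Lemma index_scen_order j : (index j o < S)%N.
Proof. by rewrite -[ltnRHS]size_scen_order index_mem mem_scen_order. Qed.

Lemma sum_scen_order (F : 'I_S -> R) :
  \sum_(j < S) F j = \sum_(m < S) F (nth i0 o m).
Proof.
have -> : \sum_(j < S) F j = \sum_(j <- o) F j.
  by rewrite -big_enum /=; apply: perm_big; rewrite perm_sym perm_sort.
by rewrite (big_nth i0) size_scen_order big_mkord.
Qed.

Lemma nth_sorted_probs m : (m < S)%N -> nth 0 (sorted_probs p v) m = p (nth i0 o m).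
Proof. by move=> mS; rewrite (nth_map i0) ?size_scen_order. Qed.

Lemma nth_sorted_vals m : (m < S)%N -> nth 0 (sorted_vals v) m = v (nth i0 o m).
Proof. by move=> mS; rewrite (nth_map i0) ?size_scen_order. Qed.

Lemma scen_order_le m m' : (m <= m')%N -> (m' < S)%N ->
  v (nth i0 o m) <= v (nth i0 o m').
Proof.
move=> mm' m'S.
have vtr : transitive (fun i j => v i <= v j) by move=> ? ? ?; exact: le_trans.
have vtot : total (fun i j => v i <= v j) by move=> ? ?; exact: le_total.
have vrefl : reflexive (fun i j => v i <= v j) by move=> ?; exact: lexx.
apply: (sorted_leq_nth vtr vrefl) => //.
- exact: sort_sorted.
- by rewrite inE size_scen_order (leq_ltn_trans mm').
- by rewrite inE size_scen_order.
Qed.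

Lemma sum_lt_ord (F : nat -> R) m : (m <= S)%N ->
  \sum_(j < m) F j = \sum_(j < S) (if (j < m)%N then F j else 0).
Proof. by move=> mS; rewrite (big_ord_widen _ F mS) big_mkcond. Qed.

Lemma psum_full : psum p v S = 1.
Proof.
rewrite -p1 (sum_scen_order p); apply: eq_bigr => j _.
exact: nth_sorted_probs.
Qed.

(** The index 0 qualifies because the empty sum is below [a], so the maximum is attained; [S] does
    not, the total mass being [1 > a]. Maximality gives the upper inequality. *)
Lemma cvar_kP : (k < S)%N /\ psum p v k < a <= psum p v k.+1.
Proof.
case/andP: a01 => a0 a1.
have : (0 < #|[pred m : 'I_S.+1 | (psum p v m < a)%R]|)%N.
  by apply/card_gt0P; exists ord0; rewrite inE /psum big_ord0.
move=> /(eq_bigmax_cond (fun m : 'I_S.+1 => (m : nat)))[m].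
rewrite inE => ma km; have {km} : k = m by rewrite /k /cvar_k -km.
move=> kE; have kS : (k < S)%N.
  rewrite ltn_neqAle {2}kE -ltnS ltn_ord andbT; apply/eqP => kS.
  by move: ma; rewrite -kE kS psum_full ltNge (ltW a1).
split=> //; rewrite {1}kE ma leNgt; apply/negP => ka.
have : (k.+1 <= k)%N.
  have kS' : (k.+1 < S.+1)%N by [].
  by apply: (bigop.bigmax_sup (Ordinal kS')).
by rewrite ltnn.
Qed.

Lemma cvar_eps_bounds : 0 < eps <= p (nth i0 o k).
Proof.
have [kS /andP[h1 h2]] := cvar_kP; rewrite subr_gt0 h1/= lerBlDl.
by apply: le_trans h2 _; rewrite /psum big_ord_recr/= nth_sorted_probs.
Qed.

Lemma cvar_valsE : a * cvar_vals p v a =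
  \sum_(m < S) (if (m < k)%N then p (nth i0 o m) * v (nth i0 o m) else 0)
  + eps * v (nth i0 o k).
Proof.
have [kS _] := cvar_kP; case/andP: a01 => a0 _.
rewrite /cvar_vals -/k -/eps nth_sorted_vals// mulrDr mulVKf ?gt_eqF//.
congr (_ + _); last by field; rewrite gt_eqF.
rewrite (sum_lt_ord
  (fun j => nth 0 (sorted_probs p v) j * nth 0 (sorted_vals v) j) _ (ltnW kS)).
by apply: eq_bigr => j _; rewrite nth_sorted_probs// nth_sorted_vals.
Qed.

Lemma psum_kE : psum p v k = \sum_(m < S) (if (m < k)%N then p (nth i0 o m) else 0).
Proof.
have [kS _] := cvar_kP; rewrite /psum (sum_lt_ord _ _ (ltnW kS)).
by apply: eq_bigr => j _; rewrite nth_sorted_probs.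
Qed.

(* [a * CVaR_a] is the value of the linear program minimising [\sum_j q_j v_j]
   over [0 <= q <= p], [\sum_j q_j = a]: the optimum fills the smallest
   values first. *)
Lemma cvar_vals_attained : exists q : 'I_S -> R,
  [/\ forall j, 0 <= q j <= p j, \sum_(j < S) q j = a &
      a * cvar_vals p v a = \sum_(j < S) q j * v j].
Proof.
have [kS _] := cvar_kP; have /andP[e0 ep] := cvar_eps_bounds.
(* Full mass on the [k] smallest values and the remainder [eps] on position [k], which counted from
   1 is scenario [k + 1]. *)
pose q j := (if (index j o < k)%N then p j else 0)
  + (if index j o == k then eps else 0).
have qE m : (m < S)%N -> q (nth i0 o m) =
    (if (m < k)%N then p (nth i0 o m) else 0) + (if m == k then eps else 0).
  by move=> mS; rewrite /q index_uniq ?size_scen_order// scen_order_uniq.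
have sum_k (F : nat -> R) : \sum_(m < S) (if m == k :> nat then F m else 0) = F k.
  by rewrite -big_mkcond (big_pred1 (Ordinal kS)).
exists q; split.
- move=> j; have {1 2 3}-> : j = nth i0 o (index j o).
    by rewrite nth_index ?mem_scen_order.
  rewrite qE ?index_scen_order//; set m := index j o.
  have /andP[pm0 _] := p01 (nth i0 o m).
  have [mk|mk|->] := ltngtP m k; rewrite ?addr0 ?add0r ?lexx ?pm0//.
  by rewrite (ltW e0).
- rewrite (sum_scen_order q); under eq_bigr do rewrite qE//.
  rewrite big_split/= -psum_kE (sum_k (fun=> eps)) /eps /cvar_eps.
  by rewrite addrC subrK.
- rewrite cvar_valsE (sum_scen_order (fun j => q j * v j)).
  under [RHS]eq_bigr do rewrite qE// mulrDl.
  rewrite big_split/= -(sum_k (fun m => eps * v (nth i0 o m))); congr (_ + _).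
    by apply: eq_bigr => m _; case: ifP; rewrite ?mul0r.
  by apply: eq_bigr => m _; case: ifP; rewrite ?mul0r.
Qed.

(** After subtracting [a * t], with [t] the value at position [k], terms compare one by one: before
    [k] the factor [v - t] is nonpositive and [q <= p]; from [k] on it is nonnegative and
    [q >= 0]. *)
Lemma cvar_vals_le (q : 'I_S -> R) :
  (forall j, 0 <= q j <= p j) -> \sum_(j < S) q j = a ->
  a * cvar_vals p v a <= \sum_(j < S) q j * v j.
Proof.
move=> qp qa; have [kS _] := cvar_kP; pose t := v (nth i0 o k).
suff : a * cvar_vals p v a - a * t <= \sum_(j < S) q j * v j - a * t.
  by rewrite lerD2r.
rewrite -{4}qa mulr_suml -sumrB cvar_valsE -/t.
have -> : \sum_(m < S) (if (m < k)%N then p (nth i0 o m) * v (nth i0 o m) else 0)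
    + eps * t - a * t
  = \sum_(m < S) (if (m < k)%N then p (nth i0 o m) * (v (nth i0 o m) - t) else 0).
  rewrite /eps /cvar_eps -/k psum_kE mulrBl addrA addrAC addrK mulr_suml -sumrB.
  by apply: eq_bigr => m _; case: ifP => _; rewrite ?mul0r ?subr0 ?mulrBr.
rewrite (sum_scen_order (fun j => q j * v j - q j * t)).
apply: ler_sum => m _; rewrite -mulrBr.
have /andP[q0 q1] := qp (nth i0 o m).
case: ltnP => mk.
  by rewrite ler_wnM2r// subr_le0 scen_order_le// ltnW.
by rewrite mulr_ge0// subr_ge0 scen_order_le.
Qed.

End cvar.

(** Weights [q] optimal for [w] remain feasible for every other portfolio, so [- a^-1] times the
    [q]-combination of the scenarios is a subgradient at [w]; [q <= p <= 1] bounds it uniformly. *)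
Lemma lip_convexNCVaR (R : realType) (n S : nat) (x : 'I_S -> 'rV[R]_n)
    (p : 'I_S -> R) (a : R) :
  (forall j, 0 <= p j <= 1) -> \sum_(j < S) p j = 1 -> 0 < a < 1 ->
  lip_convex (fun w => - CVaR x p a w).
Proof.
move=> p01 p1 a01; case/andP: (a01) => a0 _.
exists (a^-1 * \sum_(i < n) \sum_(j < S) `|x j 0 i|) => w.
have [q [qp qa qE]] := cvar_vals_attained p (port_vals x w) a p01 p1 a01.
pose s := \sum_(j < S) q j *: x j.
have sE z : dotv s z = \sum_(j < S) q j * dotv z (x j).
  by rewrite dotv_suml; apply: eq_bigr => j _; rewrite dotvZl dotvC.
exists ((- a^-1) *: s); split=> [i|z].
  have ia0 : 0 <= a^-1 by rewrite invr_ge0 ltW.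
  rewrite mxE normrM normrN (ger0_norm ia0); apply: (ler_wpM2l ia0).
  apply: (@le_trans _ _ (\sum_(j < S) `|x j 0 i|)); last first.
    by rewrite (bigD1 i)//= lerDl; do 2?[apply: sumr_ge0 => ? _].
  rewrite summxE (le_trans (ler_norm_sum _ _ _))//; apply: ler_sum => j _.
  have /andP[q0 q1] := qp j; have /andP[_ pj] := p01 j.
  by rewrite mxE normrM ger0_norm// ler_piMl// (le_trans q1).
have := cvar_vals_le p (port_vals x z) a p1 a01 q qp qa.
rewrite -sE dotvZl dotvBr (sE w) -qE /CVaR => h.
have : a^-1 * (a * cvar_vals p (port_vals x z) a) <= a^-1 * dotv s z.
  by rewrite ler_wpM2l// invr_ge0 ltW.
rewrite mulrBr !mulNr mulKf ?gt_eqF//; rewrite mulKf ?gt_eqF//; lra.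
Qed.

(** * Limits, compactness and convergence of the DC iteration *)

Section sequences.
Context {R : realType} {n : nat}.
Implicit Types (f g h : 'rV[R]_n -> R) (z : nat -> 'rV[R]_n) (zb : 'rV[R]_n).

Lemma ler_cvgn (a b : nat -> R) (l l' : R) : a @ \oo --> l -> b @ \oo --> l' ->
  (forall k, a k <= b k) -> l <= l'.
Proof. by move=> al bl ab; apply: (ler_cvg_to al bl); near=> k; exact: ab.
Unshelve. all: by end_near. Qed.

Definition coord_cvg z zb := forall i, (fun k => z k 0 i) @ \oo --> zb 0 i.

Lemma coord_cvg_cvg z zb : coord_cvg z zb -> z @ \oo --> zb.
Proof.
move=> zzb; apply/cvg_ballP => e e0.
have : \forall k \near \oo, forall i, ball (zb 0 i) e (z k 0 i).
  by apply: filter_forall => i; move/cvg_ballP : (zzb i); exact.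
apply: filterS => k hk; split=> // i j; rewrite (ord1 i); exact: hk.
Qed.

Lemma cvg_sum_seq (I : Type) (r : seq I) (F : I -> nat -> R) (l : I -> R) :
  (forall i, F i @ \oo --> l i) ->
  (fun k => \sum_(i <- r) F i k) @ \oo --> \sum_(i <- r) l i.
Proof.
move=> Fl; elim: r => [|i r ih].
  by rewrite big_nil; under eq_fun do rewrite big_nil; exact: cvg_cst.
by rewrite big_cons; under eq_fun do rewrite big_cons; exact: cvgD.
Qed.

Lemma coord_cvg_cst zb : coord_cvg (fun=> zb) zb.
Proof. by move=> i; exact: cvg_cst. Qed.

Lemma coord_cvgB z zb z' zb' : coord_cvg z zb -> coord_cvg z' zb' ->
  coord_cvg (fun k => z k - z' k) (zb - zb').
Proof.
move=> zc z'c i; rewrite !mxE; under eq_fun do rewrite !mxE.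
exact: cvgB.
Qed.

Lemma coord_cvgD z zb z' zb' : coord_cvg z zb -> coord_cvg z' zb' ->
  coord_cvg (fun k => z k + z' k) (zb + zb').
Proof.
move=> zc z'c i; rewrite !mxE; under eq_fun do rewrite !mxE.
exact: cvgD.
Qed.

Lemma cvg_dotv z zb z' zb' : coord_cvg z zb -> coord_cvg z' zb' ->
  (fun k => dotv (z k) (z' k)) @ \oo --> dotv zb zb'.
Proof. by move=> zc z'c; apply: cvg_sum_seq => i; exact: cvgM. Qed.

Lemma psi_convex_cvg rho f z zb : psi_convex rho f -> coord_cvg z zb ->
  (fun k => f (z k)) @ \oo --> f zb.
Proof.
move=> [L /lip_convex_lipschitz[M M0 LM] fE] zc; rewrite fE.
under eq_fun do rewrite fE.
apply: cvgD; first by apply: cvgMr; exact: cvg_dotv.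
apply/subr_cvg0/norm_cvg0P.
apply: (@squeeze_cvgr _ _ _ _ (fun=> 0)
  (fun k => M * \sum_(i < n) `|(z k - zb) 0 i|)); first 2 last.
- rewrite -[X in _ --> X](mulr0 M); apply: cvgMr.
  rewrite [X in _ --> X](_ : 0 = \sum_(i < n) 0); last by rewrite big1.
  apply: (cvg_sum_seq _ _ (fun i k => `|(z k - zb) 0 i|)) => i.
  have := coord_cvgB _ _ _ _ zc (coord_cvg_cst zb) i.
  by rewrite subrr mxE => /cvg_norm; rewrite normr0.
- by near=> k; rewrite normr_ge0/=.
- exact: cvg_cst.
Unshelve. all: by end_near. Qed.

Lemma increasing_seq_cvg (s : nat -> nat) : increasing_seq s -> s @ \oo --> \oo.
Proof.
move=> si; apply/cvgnyPge => A; exists A => // k /= Ak.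
have ks : (k <= s k)%N.
  elim: {Ak} k => // k ih; apply: leq_ltn_trans ih _.
  have := si k.+1 k; rewrite ltnn leEnat => /negbT; rewrite -ltnNge; exact.
exact: leq_trans ks.
Qed.

(** One extraction per index of [r]; further extraction preserves the limits already obtained. *)
Lemma bolzano_weierstrass_seq (I : eqType) (r : seq I) (F : I -> nat -> R) B :
  (forall i k, `|F i k| <= B) ->
  exists2 s : nat -> nat, increasing_seq s &
    forall i, i \in r -> cvgn (fun k => F i (s k)).
Proof.
move=> FB; elim: r => [|i r [s si sr]]; first by exists id.
have bF : bounded_fun (fun k => F i (s k)).
  exists B; split; first exact: num_real.
  by move=> x Bx k _ /=; rewrite (le_trans (FB _ _))// ltW.
have [t ti tr] := bolzano_weierstrass bF.
exists (s \o t); first by move=> a b /=; rewrite si -leEnat ti.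
move=> j; rewrite inE => /orP[/eqP -> //|jr].
have /cvg_ex[l hl] := sr j jr; apply/cvg_ex; exists l.
exact: cvg_comp (increasing_seq_cvg _ ti) hl.
Qed.

(** The subgradient inequality is tested at [w] plus or minus a basis vector: [psi] grows by at most
    [rho / 2 * (2 + 1)] since [w 0 i <= 1], and the Lipschitz part by at most [M]. *)
Lemma psi_convex_subdiff_bounded rho h : 0 <= rho -> psi_convex rho h ->
  exists B, forall w u, in_simplex w -> subdiff h w u -> forall i, `|u 0 i| <= B.
Proof.
move=> rho0 [L /lip_convex_lipschitz[M M0 LM] hE].
exists (rho / 2 * 3 + M) => w u [w01 _] hu i.
have step t : `|t| = 1 -> t * u 0 i <= rho / 2 * 3 + M.
  move=> t1; have := hu (w + t *: delta_mx 0 i).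
  rewrite addrAC subrr add0r dotvZr dotv_delta !hE /psi sqnormD dotvZr dotv_delta.
  have -> : sqnorm (t *: delta_mx 0 i : 'rV[R]_n) = 1.
    rewrite /sqnorm dotvZr dotv_delta !mxE !eqxx /= mulr1 -expr2.
    by rewrite -[t ^+ 2]real_normK ?num_real// t1 expr1n.
  have := LM (w + t *: delta_mx 0 i) w.
  rewrite addrAC subrr add0r (bigD1 i)//= big1; last first.
    by move=> j ji; rewrite !mxE (negbTE ji) andbF mulr0 normr0.
  rewrite !mxE !eqxx /= mulr1 t1 addr0 mulr1 ler_norml => /andP[_ hL] hs.
  have /andP[wi0 wi1] := w01 i.
  have tw : t * w 0 i <= 1.
    apply: (le_trans (ler_norm _)); rewrite normrM t1 mul1r.
    by rewrite ger0_norm.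
  have : rho / 2 * (2 * (t * w 0 i)) <= rho / 2 * 2.
    by apply: ler_wpM2l; [rewrite divr_ge0 | lra].
  lra.
have := step 1 (normr1 _); have := step (-1) (normrN1 _).
by rewrite mulN1r mul1r ler_norml => h1 h2; apply/andP; split; lra.
Qed.

(** The quadratic parts cancel, and the Lipschitz remainders are compared with their values at 0, at
    l1-distance 1 from every point of the simplex. *)
Lemma psi_convex_diff_lbounded rho g h : psi_convex rho g -> psi_convex rho h ->
  exists m, forall w, in_simplex w -> m <= g w - h w.
Proof.
move=> [L /lip_convex_lipschitz[M M0 LM] gE] [L' /lip_convex_lipschitz[M' M'0 LM'] hE].
exists (L 0 - M - (L' 0 + M')) => w /in_simplexP[w0 w1].
have sw : \sum_(i < n) `|(w - 0) 0 i| = 1.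
  by rewrite subr0 -w1; apply: eq_bigr => i _; rewrite ger0_norm.
have := LM w 0; have := LM' w 0; rewrite sw !mulr1 !ler_norml gE hE.
by move=> /andP[? ?] /andP[? ?]; lra.
Qed.

(** Strong convexity of [g] at [y] and of [h] at [w] contribute [rho / 2] each; the terms in [u]
    cancel in the sum. *)
Lemma dca_decrease rho g h w y u : 0 <= rho ->
  psi_convex rho g -> psi_convex rho h ->
  in_simplex w -> in_simplex y -> subdiff h w u ->
  (forall v, in_simplex v -> g y - dotv y u <= g v - dotv v u) ->
  g y - h y <= g w - h w - rho * sqnorm (y - w).
Proof.
move=> rho0 /psi_convex_strongly gc /psi_convex_strongly hc Dw Dy hu ymin.
have := strongly_convex_min _ _ _ _ _ rho0
  (strongly_convexB_linear _ _ u gc) simplex_convex Dy Dw ymin.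
have := strongly_convex_subdiff _ _ _ _ y rho0 hc hu.
by rewrite -(opprB y w) sqnormN dotvBr !(dotvC u); lra.
Qed.

Lemma simplex_closed z zb : (forall k, in_simplex (z k)) -> coord_cvg z zb ->
  in_simplex zb.
Proof.
move=> Dz zc; apply/in_simplexP; split=> [i|].
  apply: (ler_cvgn _ _ _ _ (cvg_cst 0) (zc i)) => k.
  by have /in_simplexP[] := Dz k.
have : (fun k => \sum_(i < n) z k 0 i) @ \oo --> \sum_(i < n) zb 0 i.
  exact: cvg_sum_seq.
have -> : (fun k => \sum_(i < n) z k 0 i) = cst 1.
  by apply/funext => k; have /in_simplexP[] := Dz k.
by move=> /cvg_unique; apply=> //; exact: cvg_cst.
Qed.

Lemma dca_subsequence_KKT rho g h (w y u : nat -> 'rV[R]_n) : 0 <= rho ->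
  psi_convex rho g -> psi_convex rho h ->
  (forall k, in_simplex (w k)) ->
  (forall k, subdiff h (w k) (u k)) ->
  (forall k v, in_simplex v -> g (y k) - dotv (y k) (u k) <= g v - dotv v (u k)) ->
  coord_cvg (fun k => y k - w k) 0 ->
  exists (sg : nat -> nat) (wb : 'rV[R]_n),
    (forall k, (sg k < sg k.+1)%N) /\
    (fun k => w (sg k)) @ \oo --> wb /\ is_KKT g h wb.
Proof.
move=> rho0 gc hc Dw hu ymin d0.
have [B uB] := psi_convex_subdiff_bounded _ _ rho0 hc.
(* The sum type lets one extraction serve the coordinates of both [w] and [u]. *)
pose F (i : 'I_n + 'I_n) k := match i with inl i => w k 0 i | inr i => u k 0 i end.
have FB i k : `|F i k| <= Num.max 1 B.
  rewrite le_max; case: i => i /=; last by rewrite (uB _ _ (Dw k) (hu k)) orbT.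
  have [/(_ i)/andP[w0 w1] _] := Dw k.
  by rewrite ger0_norm// w1.
have [s si sF] := bolzano_weierstrass_seq _ (index_enum ('I_n + 'I_n)%type) _ _ FB.
pose wb : 'rV[R]_n := \row_i lim (F (inl i) (s k) @[k --> \oo]).
pose ub : 'rV[R]_n := \row_i lim (F (inr i) (s k) @[k --> \oo]).
have wc : coord_cvg (fun k => w (s k)) wb.
  by move=> i; rewrite mxE; exact: (sF (inl i) (mem_index_enum _)).
have uc : coord_cvg (fun k => u (s k)) ub.
  by move=> i; rewrite mxE; exact: (sF (inr i) (mem_index_enum _)).
have yc : coord_cvg (fun k => y (s k)) wb.
  have dc : coord_cvg (fun k => y (s k) - w (s k)) 0.
    by move=> i; exact: cvg_comp (increasing_seq_cvg _ si) (d0 i).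
  have := coord_cvgD _ _ _ _ dc wc; rewrite add0r.
  by congr coord_cvg; apply/funext => k; rewrite subrK.
exists s, wb; split; first by move=> k; rewrite ltnNge -leEnat si ltnn.
split; first exact: coord_cvg_cvg.
apply: (@simplex_min_KKT _ _ _ _ _ ub).
- apply: (strongly_convex_convex rho) => //.
  by apply: strongly_convexB_linear; exact: psi_convex_strongly.
- move=> z; apply: (ler_cvgn (fun k => h (w (s k)) + dotv (u (s k)) (z - w (s k)))
    (fun=> h z)) => [||k]; last exact: hu.
  + apply: cvgD; first exact: (psi_convex_cvg _ _ _ _ hc wc).
    by apply: cvg_dotv => //; apply: coord_cvgB => //; exact: coord_cvg_cst.
  + exact: cvg_cst.
- by apply: (simplex_closed _ _ _ wc) => k; exact: Dw.
- move=> z Dz; apply: (ler_cvgn (fun k => g (y (s k)) - dotv (y (s k)) (u (s k)))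
    (fun k => g z - dotv z (u (s k)))) => [||k]; last exact: ymin.
  + by apply: cvgB; [exact: (psi_convex_cvg _ _ _ _ gc yc) | exact: cvg_dotv].
  + apply: cvgB; first exact: cvg_cst.
    by apply: cvg_dotv => //; exact: coord_cvg_cst.
Qed.

(** Consecutive differences of a convergent sequence tend to 0, and here they dominate [rho] times
    the square of each coordinate of [d k]. *)
Lemma sufficient_decrease_cvg0 rho (phi : nat -> R) (d : nat -> 'rV[R]_n) :
  0 < rho -> cvgn phi ->
  (forall k, phi k.+1 <= phi k - rho * sqnorm (d k)) -> coord_cvg d 0.
Proof.
move=> rho0 /cvg_ex[l phil] dec i; rewrite mxE.
have diff0 : (fun k => phi k - phi k.+1) @ \oo --> 0.
  rewrite -(subrr l); apply: cvgB => //.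
  by rewrite (cvg_shiftS phi).
apply/cvgr0Pnorm_le => e e0.
have re0 : 0 < rho * e ^+ 2 by rewrite mulr_gt0// exprn_gt0.
have /cvgr0Pnorm_le/(_ _ re0) := diff0; apply: filterS => k /(le_trans (ler_norm _)) hk.
have : rho * (d k 0 i) ^+ 2 <= rho * e ^+ 2.
  apply: le_trans hk; have := dec k.
  have := ler_wpM2l (ltW rho0) (sqr_coord_le_sqnorm (d k) i); lra.
rewrite ler_pM2l// -[d k 0 i ^+ 2]real_normK ?num_real//.
by rewrite ler_pXn2r// ?nnegrE ?normr_ge0// ltW.
Qed.

End sequences.

(** * Structure of [g] and [h] for the portfolio data *)

Section portfolio.
Context {R : realType} {n S : nat}.
Variables (x : 'I_S -> 'rV[R]_n) (p : 'I_S -> R) (al ga rmin tau rho : R).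
Hypotheses (p01 : forall j, 0 <= p j <= 1) (p1 : \sum_(j < S) p j = 1).
Hypotheses (al01 : 0 < al < 1) (tau_gt0 : 0 < tau).
Hypothesis ga_eps : forall v : 'rV[R]_n, 0 < ga < CVaR_eps x p al v.

(** [CVaR_eps] is [al] minus a nonnegative partial sum, so [ga < al] and [al - ga] is a legitimate
    CVaR level. *)
Lemma level_diff_bounds : 0 < al - ga < 1.
Proof.
case/andP: al01 => al0 al1; have /andP[ga0 gae] := ga_eps 0.
have psum0 : 0 <= psum p (port_vals x 0) (cvar_k p (port_vals x 0) al).
  apply: sumr_ge0 => j _; rewrite /sorted_probs.
  set o := scen_order _; have [jS|jS] := ltnP j (size [seq p i | i <- o]).
    by have /mapP[i _ ->] := mem_nth 0 jS; case/andP: (p01 i).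
  by rewrite nth_default.
by move: gae; rewrite /CVaR_eps /cvar_eps => gae; apply/andP; split; lra.
Qed.

Lemma level_ratio_ge0 : 0 <= (al - ga) / ga.
Proof.
case/andP: level_diff_bounds => d0 _; have /andP[ga0 _] := ga_eps 0.
by rewrite divr_ge0// ltW.
Qed.

Lemma psi_convex_gfun : psi_convex rho (gfun x p al ga rmin tau rho).
Proof.
have /andP[ga0 _] := ga_eps 0; have /andP[al0 _] := al01.
pose s := - \sum_(j < S) p j *: x j.
exists (fun w => dotv s w + tau * Num.max (al / ga * - CVaR x p al w + rmin)
                                 ((al - ga) / ga * - CVaR x p (al - ga) w)).
- apply: lip_convexD; first exact: lip_convex_linear.
  apply: lip_convexZ; first exact: ltW.
  apply: lip_convex_max.
    apply: lip_convexD; last exact: lip_convex_cst.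
    apply: lip_convexZ; first by rewrite divr_ge0// ltW.
    exact: lip_convexNCVaR.
  apply: lip_convexZ; first exact: level_ratio_ge0.
  exact: lip_convexNCVaR level_diff_bounds.
- move=> w; rewrite /gfun !mulrN !mulNr addrA; congr (_ + _ + _).
  rewrite /ffun_obj /s dotvNl dotv_suml; congr (- _); apply: eq_bigr => j _.
  by rewrite dotvZl dotvC.
Qed.

Lemma psi_convex_hfun : psi_convex rho (hfun x p al ga tau rho).
Proof.
exists (fun w => tau * ((al - ga) / ga) * - CVaR x p (al - ga) w).
- apply: lip_convexZ; first by rewrite mulr_ge0 ?level_ratio_ge0// ltW.
  exact: lip_convexNCVaR level_diff_bounds.
- by move=> w; rewrite /hfun mulrN.
Qed.

End portfolio.

(** Stopping is encoded by repeating the iterate when [y k = w k]. The line-search output is granted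
    only if some trial is accepted, so termination is proved rather than assumed. *)
Theorem theorem1 (R : realType) (n S : nat) (x : 'I_S -> 'rV[R]_n) (p : 'I_S -> R)
  (al ga rmin tau rho beta : R)
  (w y u : nat -> 'rV[R]_n) (lam : nat -> R) :
  (forall j, 0 <= p j <= 1) -> \sum_(j < S) p j = 1 ->
  0 < al < 1 ->
  (forall v : 'rV[R]_n, 0 < ga < CVaR_eps x p al v) ->
  0 < tau -> 0 < rho -> 0 < beta < 1 ->
  in_simplex (w 0%N) ->
  (forall k, subdiff (hfun x p al ga tau rho) (w k) (u k)) ->
  (forall k, in_simplex (y k) /\
     forall z, in_simplex z ->
       gfun x p al ga rmin tau rho (y k) - dotv (y k) (u k)
         <= gfun x p al ga rmin tau rho z - dotv z (u k)) ->
  (forall k, y k = w k -> w k.+1 = w k) ->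
  (forall k, y k != w k ->
     (exists j, armijo (phifun x p al ga rmin tau rho) rho (w k) (y k - w k)
                  (ls_trial beta (lam_max (w k) (y k - w k)) j)) ->
     ls_output (phifun x p al ga rmin tau rho) rho beta (w k) (y k - w k) (lam k)) ->
  (forall k, y k != w k -> w k.+1 = w k + lam k *: (y k - w k)) ->
  let phi := phifun x p al ga rmin tau rho in
  (* (i) *)
  (forall k, phi (y k) <= phi (w k) - rho * sqnorm (y k - w k)) /\
  (* (ii) *)
  (forall k, y k != w k ->
     exists j, armijo phi rho (w k) (y k - w k)
                 (ls_trial beta (lam_max (w k) (y k - w k)) j)) /\
  (forall k, phi (w k.+1) <= phi (w k) - rho * lam k ^+ 2 * sqnorm (y k - w k)) /\
  (* (iii) *)
  (forall k, phi (w k.+1) <= phi (w k)) /\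
  (exists phib : R, (fun k => phi (w k)) @ \oo --> phib) /\
  (* (iv) *)
  (exists (sg : nat -> nat) (wb : 'rV[R]_n),
     (forall k, (sg k < sg k.+1)%N) /\
     (fun k => w (sg k)) @ \oo --> wb /\
     is_KKT (gfun x p al ga rmin tau rho) (hfun x p al ga tau rho) wb).
Proof.
move=> p01 p1 al01 ga_eps tau0 rho0 beta01 Dw0 hu ymin stop ls step phi.
set g := gfun x p al ga rmin tau rho in ymin phi *.
set h := hfun x p al ga tau rho in hu phi *.
have gc : psi_convex rho g by exact: psi_convex_gfun.
have hc : psi_convex rho h by exact: psi_convex_hfun.
have rho_ge0 := ltW rho0.
have decr k : in_simplex (w k) ->
    phi (y k) <= phi (w k) - rho * sqnorm (y k - w k).
  move=> Dw; have [Dy yk] := ymin k.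
  exact: dca_decrease gc hc Dw Dy (hu k) yk.
(* The trial step 1 leads to [y k], where the Armijo test is exactly the decrease (i). *)
have terminates k : in_simplex (w k) -> y k != w k ->
    exists j, armijo phi rho (w k) (y k - w k)
                (ls_trial beta (lam_max (w k) (y k - w k)) j).
  move=> Dw yw; have [Dy _] := ymin k.
  have [_ l1] := lam_max_ge1 _ _ Dw Dy yw.
  have [j trial1] := ls_trial_eventually1 _ _ beta01 l1; exists j.
  by rewrite trial1 /armijo scale1r addrC subrK expr1n mulr1; exact: decr.
have search k : in_simplex (w k) -> y k != w k ->
    [/\ armijo phi rho (w k) (y k - w k) (lam k) &
        1 <= lam k <= lam_max (w k) (y k - w k)].
  move=> Dw yw; have [Dy _] := ymin k.
  have [j [arm [_ ->]]] := ls k yw (terminates k Dw yw); split=> //.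
  have [_ l1] := lam_max_ge1 _ _ Dw Dy yw.
  exact: ls_trial_bounds.
(* The facts above take feasibility of [w k] as a premise; it propagates because the accepted step
   lies between 1 and [lam_max]. *)
have Dw k : in_simplex (w k).
  elim: k => // k Dwk; have [/stop ->//|yw] := eqVneq (y k) (w k).
  have [_ lamk] := search k Dwk yw; have [Dy _] := ymin k.
  by rewrite step//; exact: simplex_step.
have dec_lam k : phi (w k.+1) <= phi (w k) - rho * lam k ^+ 2 * sqnorm (y k - w k).
  have [yw|yw] := eqVneq (y k) (w k).
    by rewrite (stop k yw) yw subrr /sqnorm dotv0r mulr0 subr0.
  by rewrite step//; have [] := search k (Dw k) yw.
have dec1 k : phi (w k.+1) <= phi (w k) - rho * sqnorm (y k - w k).
  have [yw|yw] := eqVneq (y k) (w k).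
    by rewrite (stop k yw) yw subrr /sqnorm dotv0r mulr0 subr0.
  apply: le_trans (dec_lam k) _; rewrite lerD2l lerN2 -mulrA ler_pM2l//.
  have [_ /andP[l1 _]] := search k (Dw k) yw.
  by rewrite ler_peMl ?sqnorm_ge0// exprn_ege1.
have mono k : phi (w k.+1) <= phi (w k).
  by apply: le_trans (dec1 k) _; rewrite gerBl mulr_ge0// sqnorm_ge0.
have phi_cvg : cvgn (fun k => phi (w k)).
  apply: nonincreasing_is_cvgn; first exact/nonincreasing_seqP.
  have [m hm] := psi_convex_diff_lbounded _ _ _ gc hc.
  by exists m => _ [k _ <-]; exact: hm.
split; first by move=> k; exact: decr.
split; first by move=> k; exact: terminates.
do 2!split=> //; split; first by exact/cvg_ex.
apply: (dca_subsequence_KKT rho g h w y u) => //.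
- by move=> k; case: (ymin k).
- exact: (sufficient_decrease_cvg0 _ _ _ rho0 phi_cvg).
Qed.
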